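(* Let $\alpha,\gamma$ be umbrae and $x\in\mathbf{x}$ a variable. A polynomial sequence $(s_n(x))_{n\ge0}$ is the Sheffer sequence of $(\gamma,\alpha)$ if and only if, for all $n\ge1$, \[ s_n(x)\simeq(x+\mathcal{K}_{\gamma,\alpha})\bigl(x+\mathcal{K}_{\gamma,\alpha}+n\boldsymbol{\cdot}\mathcal{K}_\alpha\bigr)^{n-1}. \]
   Context: Umbral calculus setting. Fix a finite set $\mathbf{x}$ of commuting variables and a further variable $z$. To every formal power series $f(z)\in\mathbb{C}[\mathbf{x}][[z]]$ with $f(0)=1$ a symbol (its umbra) is attached. The evaluation $E$ is the $\mathbb{C}[\mathbf{x}]$-linear functional on polynomials in umbrae with coefficients in $\mathbb{C}[\mathbf{x}]$ such that $E[\alpha^n]=n![z^n]f(z)$ when $\alpha$ is the umbra of $f$, and $E[\alpha^n\gamma^m\cdots\delta^l]=E[\alpha^n]E[\gamma^m]\cdots E[\delta^l]$ for pairwise distinct umbrae; elements of $\mathbb{C}[\mathbf{x}]$ (such as $x$) are constants for $E$. Write $\mathbf p\simeq\mathbf q$ if $E[\mathbf p]=E[\mathbf q]$. For an umbral polynomial $\mathbf p$ let $f_{\mathbf p}(z)=E[e^{\mathbf p z}]$. Auxiliary umbrae (treated as further umbrae, uncorrelated with all other distinct umbrae): the dot-product umbra $\mathbf p\boldsymbol{\cdot}\mathbf q$ has $f_{\mathbf p\boldsymbol{\cdot}\mathbf q}(z)=f_{\mathbf p}(\log f_{\mathbf q}(z))$; for a scalar $a$, $f_{a\boldsymbol{\cdot}\alpha}(z)=f_\alpha(z)^a$;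 for a positive integer $n$, $n\boldsymbol{\cdot}\alpha$ behaves as a sum of $n$ distinct umbrae similar to $\alpha$; $\gamma-n\boldsymbol{\cdot}\alpha$ means $\gamma+(-n\boldsymbol{\cdot}\alpha)$. The Bell umbra $\beta$ is the umbra of $e^{e^z-1}$. The derivative umbra $\alpha_D$ satisfies $f_{\alpha_D}(z)=1+zf_\alpha(z)$. For umbrae $\gamma,\alpha$, $\mathcal{K}_{\gamma,\alpha}$ denotes an umbra with $E[\mathcal{K}_{\gamma,\alpha}^n]=E[\gamma(\gamma-n\boldsymbol{\cdot}\alpha)^{n-1}]$ for all $n\ge1$, and $\mathcal{K}_\alpha=\mathcal{K}_{\alpha,\alpha}$; distinct such symbols are uncorrelated. The Sheffer sequence of $(\gamma,\alpha)$ is the polynomial sequence $s_n(x)=E[(\gamma+x\boldsymbol{\cdot}\beta\boldsymbol{\cdot}\alpha_D)^n]$, i.e. $\sum_{n\ge0}s_n(x)z^n/n!=f_\gamma(z)\,e^{xzf_\alpha(z)}$.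
   Formalization: The polynomial sequence is additionally assumed to satisfy s_0(x) = 1, since the condition for n ≥ 1 says nothing about s_0 and the converse would otherwise fail. *)

(* Defs.v *)
From HB Require Import structures.
From mathcomp Require Import all_boot all_order all_algebra.
From mathcomp Require Import finmap boolp reals complex.
From mathcomp Require Import monalg.

Set Implicit Arguments.
Unset Strict Implicit.
Unset Printing Implicit Defensive.

Import GRing.Theory.
Local Open Scope ring_scope.

(* Everything is set up over a commutative algebra A over a field C; the case  *)
(* of interest is A = {mpoly C[k]} with C the field of complex numbers.        *)
(* C is meant to have characteristic 0, as factorials are inverted.            *)

(* Formal power series in z over A are given by their coefficients in A^nat.   *)
Section PowerSeries.
Context {C : fieldType} {A : comAlgType C}.
Implicit Types (f g : nat -> A) (a : A).

Definition fps_one (n : nat) : A := (n == 0)%:R.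

Definition fps_mul f g (n : nat) : A := \sum_(i < n.+1) f i * g (n - i)%N.

Definition fps_exp f (k : nat) : nat -> A := iter k (fps_mul f) fps_one.

(* f(g(z)); only meaningful when g 0 = 0, so that g^k has no term below z^k.   *)
Definition fps_comp f g (n : nat) : A := \sum_(k < n.+1) f k * fps_exp g k n.

Definition fps_sub1 f (n : nat) : A := f n - fps_one n.

(* e^{az} *)
Definition exp_series a (n : nat) : A := n`!%:R^-1 *: a ^+ n.

(* log(1 + z); the coefficient at n = 0 is 0 since 0^-1 = 0. *)
Definition log1p_series (n : nat) : A := ((-1) ^+ n.+1 / n%:R)%:A.

(* log f(z), for f 0 = 1 *)
Definition fps_log f : nat -> A := fps_comp log1p_series (fps_sub1 f).

(* f(z)^a = e^{a log f(z)}, for f 0 = 1 *)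
Definition fps_pow f a : nat -> A := fps_comp (exp_series a) (fps_log f).

End PowerSeries.

Section Umbrae.
Context {C : fieldType} (A : comAlgType C).

(* The umbra attached to f(z) with f(0) = 1: one symbol for each such series.  *)
Record umbra := Umbra { umbra_series : nat -> A ; _ : umbra_series 0%N == 1 }.

(* All umbral symbols: the umbrae above and the auxiliary umbrae.  Distinct    *)
(* terms of this type are distinct, hence uncorrelated, symbols.               *)
(* - ScalDot a u is a.u for a scalar a, and Dot u v is u.v;                    *)
(* - AbelSym g a f is a symbol with name (g, a) and series f; it is only used  *)
(*   through abel_umbra below, where f is determined by g and a.               *)
Inductive symbol :=
  | Prim of umbra
  | AbelSym of symbol & symbol & umbra
  | ScalDot of A & symbol
  | Dot of symbol & symbol
  | Deriv of symbol.

HB.instance Definition _ := gen_eqMixin symbol.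
HB.instance Definition _ := gen_choiceMixin symbol.

Fixpoint series_of (u : symbol) : nat -> A :=
  match u with
  | Prim f => umbra_series f
  | AbelSym _ _ f => umbra_series f
  | ScalDot a v => fps_pow (series_of v) a
  | Dot v w => fps_comp (series_of v) (fps_log (series_of w))
  | Deriv v => fun n => if n is m.+1 then series_of v m else 1
  end.

(* Umbral polynomials: the free commutative A-algebra on the symbols.          *)
Local Notation upoly := {malg A[{cmonom symbol}]}.

Definition uconst (c : A) : upoly := c%:A.

Definition um (u : symbol) : upoly := << ucm u >>.

Definition moment (u : symbol) (n : nat) : A := series_of u n *+ n`!.

(* A-linear, and multiplicative over distinct symbols.                         *)
Definition E (p : upoly) : A :=
  \sum_(m <- msupp p)
     mcoeff m p * \prod_(u <- finsupp m) moment u (m u).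

Definition umbral_equiv (p q : upoly) : Prop := E p = E q.

Definition bell_series : nat -> A :=
  fps_comp (exp_series 1) (fps_sub1 (exp_series 1)).

Fact bell_series0 : bell_series 0%N == 1.
Proof.
rewrite /bell_series /fps_comp big_ord1 /exp_series fact0 expr0 invr1 scale1r.
by rewrite mul1r /fps_exp /= /fps_one eqxx.
Qed.

Definition bell_umbra : symbol := Prim (Umbra bell_series0).

(* The series whose n-th moment is E[g (g - n.a)^(n-1)] for n >= 1.            *)
Definition abel_series (g a : symbol) (n : nat) : A :=
  if n is m.+1 then
    n`!%:R^-1 *: E (um g * (um g + um (ScalDot (- n%:R) a)) ^+ m)
  else 1.

Definition abel_umbra (g a : symbol) : symbol :=
  @AbelSym g a (@Umbra (abel_series g a) (eqxx 1)).

Definition sheffer (g a : symbol) (x : A) (n : nat) : A :=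
  E ((um g + um (ScalDot x (Dot bell_umbra (Deriv a)))) ^+ n).

Definition is_sheffer_sequence (g a : symbol) (x : A) (s : nat -> A) : Prop :=
  forall n : nat, s n = sheffer g a x n.

End Umbrae.

Coercion Prim : umbra >-> symbol.

(* Main.v *)
From HB Require Import structures.
Require Import Defs.
From mathcomp Require Import all_boot all_order all_algebra.
From mathcomp Require Import finmap boolp reals complex ring.
From mathcomp Require Import monalg mpoly.
Set Implicit Arguments.
Unset Strict Implicit.
Unset Printing Implicit Defensive.
Import GRing.Theory Num.Theory.
Local Open Scope ring_scope.

(* Put [g = z f_alpha] and [b = 1 / f_alpha].  The moments of [K_{gamma,alpha}]
   are [n [z^n] f_K = [z^{n-1}] f_gamma' b^n], so Lagrange inversion gives
   [f_{K_{gamma,alpha}} o g = f_gamma], and likewise [f_{K_alpha} o g =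
   f_alpha].  With [G = e^{xz} f_{K_{gamma,alpha}}] the Sheffer generating
   series [f_gamma e^{xg}] is therefore [G o g], while the right-hand side is
   [(n-1)! [z^{n-1}] G' f_{K_alpha}^n]; the invariance of the residue under
   substitution of [g] turns the latter into [n! [z^n] (G o g)].
   Identities between exponentials, logarithms and powers of series come from
   the uniqueness of solutions of linear differential equations. *)

(** * The ring of formal power series *)

(** A separate name for [nat -> A], so that the product attached to it is the convolution [fps_mul]
    rather than the pointwise one. *)
Definition fps (C : fieldType) (A : comAlgType C) : Type := nat -> A.

Section FpsRing.
Context {C : fieldType} {A : comAlgType C}.
Implicit Types f g h : fps A.

Definition fps_trunc (N : nat) f : {poly A} := \poly_(i < N) f i.

(** Coefficient [n] of a product involves only coefficients up to [n]. Commutativity and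
    associativity are thereby inherited from polynomials. *)
Lemma fps_mul_trunc N f g n : (n < N)%N ->
  fps_mul f g n = (fps_trunc N f * fps_trunc N g)`_n.
Proof.
move=> nN; rewrite coefM; apply: eq_bigr => i _.
by rewrite !coef_poly !(leq_ltn_trans _ nN) // ?leq_subr // -ltnS.
Qed.

Lemma fps_mul_eq n f f' g g' :
    (forall i, (i <= n)%N -> f i = f' i) ->
    (forall i, (i <= n)%N -> g i = g' i) ->
  fps_mul f g n = fps_mul f' g' n.
Proof.
move=> ff' gg'; apply: eq_bigr => i _.
by rewrite ff' 1?gg' ?leq_subr // -ltnS.
Qed.

Fact fps_addA : associative (fun f g n => f n + g n : A).
Proof. by move=> f g h; apply/funext => n; rewrite addrA. Qed.

Fact fps_addC : commutative (fun f g n => f n + g n : A).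
Proof. by move=> f g; apply/funext => n; rewrite addrC. Qed.

Fact fps_add0 : left_id (fun _ => 0) (fun f g n => f n + g n : A).
Proof. by move=> f; apply/funext => n; rewrite add0r. Qed.

Fact fps_addN :
  left_inverse (fun _ => 0) (fun f n => - f n) (fun f g n => f n + g n : A).
Proof. by move=> f; apply/funext => n; rewrite addNr. Qed.

HB.instance Definition _ := gen_eqMixin (fps A).
HB.instance Definition _ := gen_choiceMixin (fps A).
HB.instance Definition _ :=
  GRing.isZmodule.Build (fps A) fps_addA fps_addC fps_add0 fps_addN.

Fact fps_mulC : commutative (@fps_mul C A).
Proof.
move=> f g; apply/funext => n.
by rewrite !(@fps_mul_trunc n.+1) // mulrC.
Qed.

Fact fps_mulA : associative (@fps_mul C A).
Proof.
have trM f g h n : fps_mul (fps_mul f g) h n =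
    (fps_trunc n.+1 f * fps_trunc n.+1 g * fps_trunc n.+1 h)`_n.
  rewrite coefM; apply: eq_bigr => i _.
  rewrite coef_poly ltnS leq_subr; congr (_ * _).
  exact: fps_mul_trunc.
by move=> f g h; apply/funext => n; rewrite fps_mulC !trM mulrC mulrA.
Qed.

Fact fps_mul1 : left_id (@fps_one C A) (@fps_mul C A).
Proof.
move=> f; apply/funext => n; rewrite /fps_mul big_ord_recl big1 ?subn0.
  by rewrite addr0 mul1r.
by move=> i _; rewrite mul0r.
Qed.

Fact fps_mulD : left_distributive (@fps_mul C A) (fun f g n => f n + g n).
Proof.
move=> f g h; apply/funext => n; rewrite -big_split /=.
by apply: eq_bigr => i _; rewrite mulrDl.
Qed.

Fact fps_one_neq0 : (@fps_one C A : fps A) != 0.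
Proof.
apply/eqP => /(congr1 (fun f : fps A => f 0%N)) /eqP.
by rewrite /fps_one /= oner_eq0.
Qed.

HB.instance Definition _ := GRing.Zmodule_isComNzRing.Build (fps A)
  fps_mulA fps_mulC fps_mul1 fps_mulD fps_one_neq0.

End FpsRing.

(** * Composition and derivation *)

Section FpsCalculus.
Context {C : fieldType} {A : comAlgType C}.
Implicit Types (f g h : fps A) (c : A).

Definition fpsC c : fps A := fun n => if n is 0 then c else 0.
Definition fpsX : fps A := fun n => (n == 1%N)%:R.
Definition fps_shift f : fps A := fun n => f n.+1.
Definition fps_deriv f : fps A := fun n => f n.+1 *+ n.+1.

Lemma fpsD f g n : (f + g) n = f n + g n. Proof. by []. Qed.
Lemma fpsN f n : (- f) n = - f n. Proof. by []. Qed.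
Lemma fpsME f g : f * g = fps_mul f g. Proof. by []. Qed.
Lemma fps_expE f k : fps_exp f k = f ^+ k.
Proof.
by elim: k => //= k IH; rewrite /fps_exp /= in IH *; rewrite IH exprS.
Qed.

Lemma fpsM f g n : (f * g) n = \sum_(i < n.+1) f i * g (n - i)%N.
Proof. by []. Qed.

Lemma fpsMn f m n : (f *+ m) n = f n *+ m.
Proof. by elim: m => // m IH; rewrite !mulrS fpsD IH. Qed.

Lemma fpsM0 f g : (f * g) 0%N = f 0%N * g 0%N.
Proof. by rewrite fpsM big_ord1. Qed.

Lemma fps_expr0 f k : f 0%N = 1 -> (f ^+ k) 0%N = 1.
Proof.
by move=> f0; elim: k => // k IH; rewrite exprS fpsM0 f0 IH mulr1.
Qed.

Lemma fpsCM c f n : (fpsC c * f) n = c * f n.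
Proof.
rewrite fpsM big_ord_recl big1 ?subn0 ?addr0 // => i _.
by rewrite mul0r.
Qed.

Lemma fpsXM0 f : (fpsX * f) 0%N = 0.
Proof. by rewrite fpsM0 mul0r. Qed.

Lemma fpsXMS f n : (fpsX * f) n.+1 = f n.
Proof.
rewrite fpsM big_ord_recl mul0r add0r big_ord_recl subn1 mul1r big1 ?addr0 //.
by move=> i _; rewrite mul0r.
Qed.

Lemma fpsC1 : fpsC 1 = 1.
Proof. by apply/funext => -[]. Qed.

Lemma fpsCN c : fpsC (- c) = - fpsC c.
Proof. by apply/funext => -[|n]; rewrite fpsN //= oppr0. Qed.

Lemma fpsC_nat n : fpsC n%:R = n%:R.
Proof. by apply/funext => -[|i]; rewrite fpsMn //= mul0rn. Qed.

Lemma fps_split f : f = fpsC (f 0%N) + fpsX * fps_shift f.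
Proof.
by apply/funext => -[|n]; rewrite fpsD ?fpsXM0 ?fpsXMS /= ?addr0 ?add0r.
Qed.

(** A factor without constant term raises the order, so coefficient [n] sees [f] only below [n]. The
    strong inductions on coefficients below rest on this. *)
Lemma fps_mull_eq g f f' n : g 0%N = 0 ->
  (forall i, (i < n)%N -> f i = f' i) -> (g * f) n = (g * f') n.
Proof.
move=> g0; case: n => [|n] ff'; first by rewrite !fpsM0 g0 !mul0r.
rewrite !fpsM big_ord_recl [RHS]big_ord_recl g0 !mul0r; congr (_ + _).
apply: eq_bigr => i _.
by rewrite lift0 subSS ff' // ltnS leq_subr.
Qed.

Lemma fps_exp_small g k n : g 0%N = 0 -> (n < k)%N -> (g ^+ k) n = 0.
Proof.
move=> g0; elim: k n => // k IH n; rewrite ltnS => nk.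
rewrite exprS (@fps_mull_eq _ _ 0) ?mulr0 // => i /leq_trans-/(_ _ nk).
exact: IH.
Qed.

Local Notation fcomp f g := (fps_comp f g : fps A).

Lemma fps_comp0 f g : fcomp f g 0%N = f 0%N.
Proof. by rewrite /fps_comp big_ord1; apply: mulr1. Qed.

Lemma fps_sumE (I : Type) (r : seq I) (P : pred I) (F : I -> fps A) n :
  (\sum_(i <- r | P i) F i) n = \sum_(i <- r | P i) F i n.
Proof. by elim/big_rec2: _ => // i y1 y2 _ <-. Qed.

(** The power [g ^+ k] has order at least [k], so the terms with [k > n] contribute nothing, and one
    finite sum serves all coefficients below [N]. *)
Lemma fps_comp_widen f g n N : g 0%N = 0 -> (n < N)%N ->
  fcomp f g n = (\sum_(k < N) fpsC (f k) * g ^+ k) n.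
Proof.
move=> g0 nN; rewrite fps_sumE /fps_comp.
rewrite (big_ord_widen N (fun k => f k * fps_exp g k n) nN).
rewrite [RHS](bigID (fun i : 'I_N => (i < n.+1)%N)) /=.
rewrite [X in _ = _ + X]big1 ?addr0 => [|i].
  by apply: eq_bigr => i _; rewrite fpsCM fps_expE.
by rewrite -leqNgt => ni; rewrite fpsCM fps_exp_small ?mulr0.
Qed.

(** Horner's rule for composition; with [fps_mull_eq] it makes composition accessible to induction
    without double sums. *)
Lemma fps_comp_split f g : g 0%N = 0 ->
  fcomp f g = fpsC (f 0%N) + g * fcomp (fps_shift f) g.
Proof.
move=> g0; apply/funext => n.
rewrite (@fps_comp_widen _ _ _ n.+2) // big_ord_recl mulr1 !fpsD; congr (_ + _).
pose S := \sum_(k < n.+1) fpsC (f k.+1) * g ^+ k.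
rewrite [RHS](@fps_mul_eq _ _ n _ g _ S) //.
  rewrite -fpsME mulr_sumr !fps_sumE; apply: eq_bigr => i _.
  by rewrite exprS mulrCA.
by move=> i; rewrite -ltnS => ?; apply: fps_comp_widen.
Qed.

Lemma fps_compD f h g : fcomp (f + h) g = fcomp f g + fcomp h g.
Proof.
apply/funext => n; rewrite fpsD -big_split; apply: eq_bigr => i _.
by rewrite fpsD mulrDl.
Qed.

Lemma fps_compCM c f g : fcomp (fpsC c * f) g = fpsC c * fcomp f g.
Proof.
apply/funext => n; rewrite fpsCM mulr_sumr; apply: eq_bigr => i _.
by rewrite fpsCM mulrA.
Qed.

Lemma fps_comp1 g : fcomp (1 : fps A) g = 1.
Proof.
apply/funext => n; rewrite /fps_comp big_ord_recl big1 ?addr0 ?mul1r //.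
by move=> i _; rewrite mul0r.
Qed.

Lemma fps_shiftX f : fps_shift (fpsX * f) = f.
Proof. by apply/funext => n; rewrite /fps_shift fpsXMS. Qed.

Lemma fps_compXM f g : g 0%N = 0 ->
  fcomp (fpsX * f) g = g * fcomp f g.
Proof.
move=> g0; rewrite fps_comp_split // fpsXM0 fps_shiftX.
by apply/funext => -[|n]; rewrite fpsD add0r.
Qed.

(** Write [f = c + z f1]. The constant part is linear, and the rest is the claim for [f1] multiplied
    by [g], which needs only coefficients below [n]. Hence the induction on [n] with [f] general. *)
Lemma fps_compM f h g : g 0%N = 0 ->
  fcomp (f * h) g = fcomp f g * fcomp h g.
Proof.
move=> g0; apply/funext => n.
elim/ltn_ind: n f => n IH f.
rewrite [in LHS](fps_split f) mulrDl -mulrA fps_compD fps_compCM fps_compXM //.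
rewrite (fps_comp_split f) // mulrDl -mulrA !fpsD; congr (_ + _).
by apply: fps_mull_eq => // i /IH ->.
Qed.

Lemma fps_compX f g k : g 0%N = 0 ->
  fcomp (f ^+ k) g = fcomp f g ^+ k.
Proof.
move=> g0; elim: k => [|k IH]; first by rewrite fps_comp1.
by rewrite exprS fps_compM // IH exprS.
Qed.

Lemma fps_derivD f g : fps_deriv (f + g) = fps_deriv f + fps_deriv g.
Proof. by apply/funext => n; rewrite /fps_deriv !fpsD mulrnDl. Qed.

Lemma fps_derivN f : fps_deriv (- f) = - fps_deriv f.
Proof. by apply/funext => n; rewrite /fps_deriv !fpsN mulNrn. Qed.

Lemma fps_derivC c : fps_deriv (fpsC c) = 0.
Proof. by apply/funext => n; rewrite /fps_deriv mul0rn. Qed.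

Lemma fps_deriv1 : fps_deriv 1 = 0.
Proof. by rewrite -fpsC1 fps_derivC. Qed.

Lemma fps_derivCM c f : fps_deriv (fpsC c * f) = fpsC c * fps_deriv f.
Proof. by apply/funext => n; rewrite fpsCM /fps_deriv fpsCM mulrnAr. Qed.

Lemma fps_derivXM f : fps_deriv (fpsX * f) = f + fpsX * fps_deriv f.
Proof.
apply/funext => -[|n]; rewrite fpsD /fps_deriv fpsXMS ?fpsXM0 ?addr0 //.
by rewrite fpsXMS mulrS.
Qed.

Lemma fps_derivM f g : fps_deriv (f * g) = fps_deriv f * g + f * fps_deriv g.
Proof.
apply/funext => n; elim/ltn_ind: n f => n IH f.
rewrite [in LHS](fps_split f) [in RHS](fps_split f) !mulrDl -!mulrA.
rewrite !fps_derivD fps_derivC fps_derivCM !fps_derivXM add0r.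
(* The Leibniz rule for the shifted series is known only below [n], which suffices behind the factor
   [fpsX]. *)
have /= e : (fpsX * fps_deriv (fps_shift f * g)) n =
   (fpsX * (fps_deriv (fps_shift f) * g + fps_shift f * fps_deriv g)) n.
  by apply: fps_mull_eq => // i /IH ->.
rewrite !fpsD e mulrDl !mulrDr -!mulrA !fpsD.
set s1 := (fpsC _ * _) n.
rewrite addrC -!addrA; congr (_ + (_ + _)).
by rewrite addrC.
Qed.

Lemma fps_derivX f k :
  fps_deriv (f ^+ k.+1) = f ^+ k * fps_deriv f *+ k.+1.
Proof.
elim: k => [|k IH]; first by rewrite mul1r.
rewrite exprS fps_derivM IH mulrnAr mulrA -exprS.
by rewrite [fps_deriv f * _]mulrC -mulrS.
Qed.

Lemma fps_deriv_comp f g : g 0%N = 0 ->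
  fps_deriv (fcomp f g) = fcomp (fps_deriv f) g * fps_deriv g.
Proof.
move=> g0; apply/funext => n; elim/ltn_ind: n f => n IH f.
rewrite [in RHS](fps_split f) (fps_comp_split f) // !fps_derivD.
rewrite !fps_derivC !add0r.
rewrite fps_derivXM fps_derivM fps_compD fps_compXM // mulrDl.
rewrite -mulrA mulrC !fpsD; congr (_ + _).
by apply: fps_mull_eq => // i /IH ->.
Qed.

End FpsCalculus.

(** * Evaluation of umbral polynomials *)

Section GeneratorPowers.
Context {I : choiceType} (B : nzRingType).
Local Notation gen u := (<< ucm u >> : {malg B[{cmonom I}]}).

(** The monomial is described by its exponents alone, so its support, which depends on whether [n]
    is zero, need not be computed. *)
Lemma malg_genX (u : I) n : exists2 m : {cmonom I},
  gen u ^+ n = << m >> & forall w, m w = ((u == w) * n)%N.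
Proof.
elim: n => [|n [m e me]]; first by exists mone => // w; rewrite cm1 muln0.
exists (mmul (ucm u) m); last by move=> w; rewrite cmM cmU me mulnS.
by rewrite exprS {}e malgM_def fgmulUU mulr1.
Qed.

Lemma malg_genXM (u v : I) i j : exists2 m : {cmonom I},
  gen u ^+ i * gen v ^+ j = << m >> &
  forall w, m w = ((u == w) * i + (v == w) * j)%N.
Proof.
have [m e me] := malg_genX u i; have [m' e' me'] := malg_genX v j.
exists (mmul m m'); last by move=> w; rewrite cmM me me'.
apply: etrans (congr2 *%R e e') _; clear e e'.
by rewrite malgM_def fgmulUU mulr1.
Qed.

End GeneratorPowers.

Section Moments.
Context {C : fieldType} {A : comAlgType C}.
Implicit Types (u v w : symbol A) (p q : {malg A[{cmonom (symbol A)}]}).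

Definition monomial_moment (m : {cmonom (symbol A)}) : A :=
  \prod_(u <- finsupp m) moment u (m u).

(** Identifies [E] with the additive extension of [monomial_moment], whence its additivity. *)
Lemma E_mmap p : E p = monalg.mmap idfun monomial_moment p.
Proof. by []. Qed.

Lemma E_Mn p n : E (p *+ n) = E p *+ n.
Proof. by rewrite !E_mmap raddfMn. Qed.

Lemma E_sum (I : Type) (r : seq I) (P : pred I)
    (F : I -> {malg A[{cmonom (symbol A)}]}) :
  E (\sum_(i <- r | P i) F i) = \sum_(i <- r | P i) E (F i).
Proof. by rewrite E_mmap raddf_sum. Qed.

Lemma E_Z c p : E (c *: p) = c * E p.
Proof.
rewrite !E_mmap (monalg.mmapEw (monalg.msuppZ_le _ _)) monalg.mmapE.
rewrite big_distrr /=.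
by apply: eq_bigr => m _; rewrite monalg.mcoeffZ mulrA.
Qed.

Lemma E_mul_constXM (x : A) n p q :
  E (p * uconst x ^+ n * q) = x ^+ n * E (p * q).
Proof. by rewrite /uconst exprZn expr1n -scalerAr -scalerAl mulr1 E_Z. Qed.

Lemma E_monomial m : E << m >> = monomial_moment m.
Proof. by rewrite E_mmap monalg.mmapU mul1r. Qed.

Lemma E_1 : E (1 : {malg A[{cmonom (symbol A)}]}) = 1.
Proof. by rewrite [LHS]E_monomial /monomial_moment mdom1 big_seq_fset0. Qed.

Lemma E_const (c : A) : E (uconst c) = c.
Proof. by rewrite /uconst E_Z E_1 mulr1. Qed.

Lemma series_of0 u : series_of u 0%N = 1.
Proof.
elim: u => [[f /= /eqP]|? _ ? _ [f /= /eqP]|c v _|v IHv w _|v _] //=.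
- by rewrite /fps_pow fps_comp0 /exp_series fact0 invr1 scale1r.
- by rewrite fps_comp0.
Qed.

Lemma moment0 u : moment u 0 = 1.
Proof. by rewrite /moment series_of0 fact0. Qed.

Lemma E_pair u v i j : u != v ->
  E (um u ^+ i * um v ^+ j) = moment u i * moment v j.
Proof.
move=> uv; have [m e me] := @malg_genXM (symbol A) A u v i j.
apply: etrans (congr1 (@E C A) e) _; clear e.
rewrite E_monomial /monomial_moment.
(* The support omits [u] or [v] when its exponent is zero. Enlarging it to both symbols is harmless
   because zeroth moments are 1. *)
rewrite (@big_fset_incl _ _ _ _ _ [fset u; v]%fset); first last.
- by move=> w _; rewrite -cmE_eq0 => /eqP ->; rewrite moment0.
- apply/fsubsetP => w; rewrite -cmE_neq0 me !inE [w == u]eq_sym [w == v]eq_sym.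
  by case: (u == w); case: (v == w).
rewrite big_fsetU1 ?inE // big_seq_fset1 !me !eqxx.
by rewrite [v == u]eq_sym (negPf uv) !mul1n !mul0n addn0.
Qed.

End Moments.

Section UncorrelatedSums.
Context {C : numFieldType} {A : comAlgType C}.
Implicit Types (u v : symbol A) (F : fps A).
Implicit Types (p q : {malg A[{cmonom (symbol A)}]}).

(** Says that [p] behaves like an umbra with series [F] uncorrelated with [v]. It covers
    [uconst x + um u], which is not a symbol. *)
Definition has_series_apart p F v := forall i j,
  E (p ^+ i * um v ^+ j) = F i *+ i`! * moment v j.

Lemma um_series_apart u v : u != v -> has_series_apart (um u) (series_of u) v.
Proof. by move=> uv i j; rewrite E_pair. Qed.

Lemma exp_series_fact (x : A) n : exp_series x n *+ n`! = x ^+ n.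
Proof.
rewrite /exp_series scalerMnl -mulr_natr mulVf ?scale1r //.
by rewrite pnatr_eq0 -lt0n fact_gt0.
Qed.

(** With moments written as [i!] times coefficients, the binomial convolution of moments becomes the
    ordinary product of series. *)
Lemma mulrn_fact_bin (a b : A) n i : (i <= n)%N ->
  (a *+ i`!) * (b *+ (n - i)`!) *+ 'C(n, i) = a * b *+ n`!.
Proof.
move=> le_in; rewrite -(bin_fact le_in) mulrnAl mulrnAr -!mulrnA.
by congr (_ *+ _); ring.
Qed.

Lemma const_add_um_series_apart x u v : u != v ->
  has_series_apart (uconst x + um u) ((exp_series x : fps A) * series_of u) v.
Proof.
move=> uv i j; rewrite addrC exprDn mulr_suml E_sum fpsM -sumrMnl mulr_suml.
apply: eq_bigr => -[l] /=; rewrite ltnS => le_li _.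
rewrite mulrnAl E_Mn E_mul_constXM E_pair // mulrA -mulrnAl; congr (_ * _).
by rewrite -exp_series_fact; apply: mulrn_fact_bin.
Qed.

Lemma E_addX p F v n : has_series_apart p F v ->
  E ((p + um v) ^+ n) = (F * series_of v) n *+ n`!.
Proof.
move=> pF; rewrite addrC exprDn E_sum fpsM -sumrMnl.
apply: eq_bigr => -[l] /=; rewrite ltnS => le_ln _.
rewrite E_Mn mulrC pF /moment.
exact: mulrn_fact_bin.
Qed.

(** The extra factor [p] raises each moment index of [p] by one, which on exponential generating
    series is derivation. *)
Lemma E_mul_addX p F v n : has_series_apart p F v ->
  E (p * (p + um v) ^+ n) = (fps_deriv F * series_of v) n *+ n`!.
Proof.
move=> pF; rewrite addrC exprDn mulr_sumr E_sum fpsM -sumrMnl.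
apply: eq_bigr => -[l] /=; rewrite ltnS => le_ln _.
rewrite mulrnAr E_Mn mulrCA -exprS mulrC pF /moment -(mulrn_fact_bin _ _ le_ln).
by rewrite /fps_deriv factS mulrnA.
Qed.

End UncorrelatedSums.

(** * Exponential, logarithm and powers *)

Section ExpLog.
Context {C : numFieldType} {A : comAlgType C}.
Implicit Types (f g y z c u : fps A) (a b : A).
Local Notation fcomp f g := (fps_comp f g : fps A).
Local Notation fexp a := (exp_series a : fps A).
Local Notation flog f := (fps_log f : fps A).
Local Notation fpow f a := (fps_pow f a : fps A).

Lemma mulrSn_eq0 a n : a *+ n.+1 = 0 -> a = 0.
Proof.
move=> an0; rewrite -[a]scale1r -(@mulVf _ n.+1%:R) ?pnatr_eq0 //.
by rewrite -scalerA scaler_nat an0 scaler0.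
Qed.

Lemma mulrSn_inj n : injective (fun a => a *+ n.+1).
Proof.
by move=> a b /eqP; rewrite -subr_eq0 -mulrnBl => /eqP /mulrSn_eq0 /subr0_eq.
Qed.

(** Coefficient [n] of the equation expresses [(n+1) y_{n+1}] through earlier coefficients of [y];
    characteristic 0 allows division by [n+1]. *)
Lemma fps_ode_eq0 u c y : u 0%N = 1 -> y 0%N = 0 ->
  fps_deriv y * u = c * y -> y = 0.
Proof.
move=> u0 y0 ode; apply/funext => n.
elim/ltn_ind: n => -[|n] IH; first exact: y0.
have := congr1 (fun f : fps A => f n) ode.
rewrite !fpsM big_ord_recr big1 /= => [|i _]; last first.
  by rewrite /fps_deriv IH ?mul0rn ?mul0r // ltnS.
rewrite add0r subnn u0 mulr1 big1 => [/mulrSn_eq0 //|i _].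
by rewrite IH ?mulr0 // ltnS leq_subr.
Qed.

Lemma fps_ode_unique u c y z : u 0%N = 1 -> y 0%N = z 0%N ->
  fps_deriv y * u = c * y -> fps_deriv z * u = c * z -> y = z.
Proof.
move=> u0 yz0 odey odez; apply: subr0_eq; apply: (@fps_ode_eq0 u c) => //.
  by rewrite fpsD fpsN yz0 subrr.
by rewrite fps_derivD fps_derivN mulrBl odey odez mulrBr.
Qed.

Lemma fps_deriv_inj y z : y 0%N = z 0%N -> fps_deriv y = fps_deriv z -> y = z.
Proof.
move=> yz0 yz'; apply/funext => -[//|n].
exact: (mulrSn_inj (congr1 (fun f : fps A => f n) yz')).
Qed.

Lemma exp_series0 a : exp_series a 0%N = 1.
Proof. by rewrite /exp_series fact0 invr1 scale1r. Qed.

Lemma fps_deriv_exp a : fps_deriv (exp_series a) = fpsC a * fexp a.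
Proof.
apply/funext => n; rewrite fpsCM /fps_deriv /exp_series.
rewrite -scaler_nat scalerA factS natrM invfM mulrA divff ?pnatr_eq0 // mul1r.
by rewrite exprS scalerAr.
Qed.

Lemma fps_deriv_exp_comp a g : g 0%N = 0 ->
  fps_deriv (fcomp (exp_series a) g) =
  fpsC a * fcomp (exp_series a) g * fps_deriv g.
Proof. by move=> g0; rewrite fps_deriv_comp // fps_deriv_exp fps_compCM. Qed.

Lemma fps_deriv_log1p : (1 + fpsX) * fps_deriv log1p_series = 1 :> fps A.
Proof.
have log1p' n : fps_deriv (@log1p_series C A) n = (-1) ^+ n.
  rewrite /fps_deriv /log1p_series -scaler_nat scalerA mulrC -mulrA.
  rewrite mulVf ?pnatr_eq0 // mulr1 !exprS !mulN1r opprK -in_algE.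
  exact: rmorph_sign.
apply/funext => -[|n]; rewrite mulrDl mul1r fpsD ?fpsXM0 ?fpsXMS !log1p'.
  by rewrite addr0.
by rewrite exprS mulN1r addNr.
Qed.

Lemma fps_compX1 g : g 0%N = 0 -> fcomp fpsX g = g.
Proof. by move=> g0; rewrite -[fpsX]mulr1 fps_compXM // fps_comp1 mulr1. Qed.

Lemma fps_sub1E f : fps_sub1 f = f - 1 :> fps A. Proof. by []. Qed.

Lemma fps_sub1_0 f : f 0%N = 1 -> fps_sub1 f 0%N = 0.
Proof. by rewrite /fps_sub1 => ->; rewrite subrr. Qed.

Lemma fps_deriv_sub1 f : fps_deriv (fps_sub1 f) = fps_deriv f.
Proof. by rewrite fps_sub1E fps_derivD fps_derivN fps_deriv1 subr0. Qed.

Lemma fps_log0 f : fps_log f 0%N = 0.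
Proof. by rewrite /fps_log fps_comp0 /log1p_series invr0 mulr0 scale0r. Qed.

Lemma fps_deriv_log f : f 0%N = 1 -> fps_deriv (fps_log f) * f = fps_deriv f.
Proof.
move=> f0; have g0 := fps_sub1_0 f0; rewrite /fps_log fps_deriv_comp //.
rewrite fps_deriv_sub1 mulrAC -[RHS]mul1r; congr (_ * _).
rewrite -(fps_comp1 (fps_sub1 f)) -fps_deriv_log1p fps_compM // fps_compD.
by rewrite fps_comp1 fps_compX1 // fps_sub1E subrKC mulrC.
Qed.

Lemma fps_pow0 f a : fps_pow f a 0%N = 1.
Proof. by rewrite /fps_pow fps_comp0 exp_series0. Qed.

Lemma fps_deriv_pow f a : f 0%N = 1 ->
  fps_deriv (fps_pow f a) * f = fpsC a * fps_deriv f * fpow f a.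
Proof.
move=> f0; rewrite /fps_pow fps_deriv_exp_comp ?fps_log0 // -mulrA.
by rewrite fps_deriv_log // mulrAC.
Qed.

(** Both sides have constant term 1 and solve [y' f = n f' y]. The other identities for [fps_pow]
    follow the same pattern. *)
Lemma fps_pow_nat f n : f 0%N = 1 -> fpow f n%:R = f ^+ n.
Proof.
move=> f0; apply: (fps_ode_unique f0 _ (fps_deriv_pow _ f0)).
  by rewrite fps_pow0 fps_expr0.
case: n => [|n]; first by rewrite expr0 fps_deriv1 !mul0r fpsC_nat !mul0r.
by rewrite fps_derivX fpsC_nat exprS; ring.
Qed.

Lemma fps_powN1 f : f 0%N = 1 -> f * fpow f (-1) = 1.
Proof.
move=> f0; apply: (@fps_ode_unique f 0) => //.
- by rewrite fpsM0 f0 fps_pow0 mulr1.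
- rewrite fps_derivM mulrDl -[X in _ + X]mulrA fps_deriv_pow // fpsCN fpsC1.
  by ring.
- by rewrite fps_deriv1 !mul0r.
Qed.

Lemma fps_deriv_inv f g : f * g = 1 -> fps_deriv f * g ^+ 2 = - fps_deriv g.
Proof.
move=> fg; have := congr1 fps_deriv fg.
rewrite fps_deriv1 fps_derivM => /(congr1 ( *%R^~ g)) /eqP.
rewrite mul0r mulrDl addr_eq0 => /eqP; rewrite -mulrA -expr2 => ->.
by rewrite mulrAC fg mul1r.
Qed.

Lemma fps_pow_oppn f g n : f 0%N = 1 -> f * g = 1 -> fpow f (- n%:R) = g ^+ n.
Proof.
move=> f0 fg; have g0 : g 0%N = 1.
  by have := congr1 (fun f : fps A => f 0%N) fg; rewrite fpsM0 f0 mul1r.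
apply: (fps_ode_unique f0 _ (fps_deriv_pow _ f0)).
  by rewrite fps_pow0 fps_expr0.
case: n => [|n]; first by rewrite fps_deriv1 fpsCN fpsC_nat oppr0 !mul0r.
rewrite fps_derivX -[fps_deriv g]opprK -(fps_deriv_inv fg) fpsCN fpsC_nat.
have -> : g ^+ n * - (fps_deriv f * g ^+ 2) *+ n.+1 * f =
    - n.+1%:R * fps_deriv f * g ^+ n.+1 * (f * g).
  by rewrite [_ ^+ n.+1]exprS; ring.
by rewrite fg mulr1.
Qed.

(** The base [W] is [e^{f-1}], since the Bell series is [e^{e^z-1}] and the logarithm undoes the
    inner exponential. Both sides then solve [y' W = a W' y]. *)
Lemma fps_pow_bell_dot f a : f 0%N = 1 ->
  fpow (fcomp (bell_series A) (fps_log f)) a =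
  fcomp (exp_series a) (fps_sub1 f).
Proof.
move=> f0; pose W := fcomp (bell_series A) (fps_log f).
have g0 := fps_sub1_0 f0; have L0 := fps_log0 f.
have W0 : W 0%N = 1 by rewrite /W fps_comp0; apply/eqP/bell_series0.
have W' : fps_deriv W = W * fps_deriv f.
  have e0 : fps_sub1 (exp_series (1 : A)) 0%N = 0.
    by rewrite fps_sub1_0 ?exp_series0.
  rewrite fps_deriv_comp // fps_deriv_exp_comp // fpsC1 mul1r fps_deriv_sub1.
  rewrite fps_deriv_exp fpsC1 mul1r fps_compM // -mulrA; congr (_ * _).
  (* That [exp] inverts [log] is the case of exponent 1 of [fps_pow_nat]. *)
  have -> : fcomp (exp_series 1) (fps_log f) = f.
    by rewrite -[RHS](fps_pow_nat 1).
  by rewrite mulrC fps_deriv_log.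
apply: (fps_ode_unique W0 _ (fps_deriv_pow _ W0)).
  by rewrite fps_pow0 fps_comp0 exp_series0.
by rewrite fps_deriv_exp_comp // fps_deriv_sub1 W'; ring.
Qed.

End ExpLog.

(** * Lagrange inversion *)

Section Lagrange.
Context {C : numFieldType} {A : comAlgType C}.
Implicit Types (f g h k M G : fps A).
Variables (a b : fps A).
Hypothesis ab1 : a * b = 1.
Hypothesis b0 : b 0%N = 1.
Local Notation fcomp f g := (fps_comp f g : fps A).
Local Notation g := (fpsX * a).

(** As [1/g = b/z], this is the residue of [g' / g^{n+1}]: it is 1 for [n = 0], and otherwise 0
    because the series is the derivative of [-g^{-n}/n]. *)
Lemma fps_residue_inv n : (fps_deriv g * b ^+ n.+1) n = (n == 0)%:R.
Proof.
rewrite fps_derivXM mulrDl exprS mulrA ab1 mul1r -mulrA fpsD.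
case: n => [|n]; first by rewrite fpsXM0 addr0.
rewrite fpsXMS exprS [b * (b * _)]mulrA -expr2 mulrA fps_deriv_inv //.
rewrite mulNr fpsN.
apply/eqP; rewrite subr_eq0; apply/eqP; apply: (@mulrSn_inj _ _ n).
by rewrite -exprS mulrC -[RHS]fpsMn -fps_derivX.
Qed.

(* The formal residue of [M z^{-n-1}] is preserved by substituting [g].      *)
Lemma fps_residue_comp M n : (fcomp M g * fps_deriv g * b ^+ n.+1) n = M n.
Proof.
elim: n M => [|n IH] M;
  rewrite fps_comp_split ?fpsXM0 // !mulrDl fpsD -mulrA fpsCM.
  by rewrite fps_residue_inv mulr1 -!mulrA fpsXM0 addr0.
have -> : g * fcomp (fps_shift M) g * fps_deriv g * b ^+ n.+2 =
    fpsX * (fcomp (fps_shift M) g * fps_deriv g * b ^+ n.+1).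
  by rewrite [b ^+ n.+2]exprS -[RHS]mul1r -ab1; ring.
by rewrite fps_residue_inv mulr0 add0r fpsXMS IH.
Qed.

Lemma lagrange_inversion f M :
    f 0%N = M 0%N ->
    (forall n, M n.+1 *+ n.+1 = (fps_deriv f * b ^+ n.+1) n) ->
  fcomp M g = f.
Proof.
move=> fM0 Mf; have g0 : g 0%N = 0 := fpsXM0 a.
apply: fps_deriv_inj; first by rewrite fps_comp0.
apply: subr0_eq; set d := _ - _.
(* By invariance of the residue, the composite and [f] have equal coefficients here. As [b] has
   constant term 1, these equations are triangular in the coefficients of [d] and force [d = 0]. *)
have d0 n : (d * b ^+ n.+1) n = 0.
  by rewrite mulrBl fpsD fpsN -Mf fps_deriv_comp // fps_residue_comp subrr.
apply/funext => n; elim/ltn_ind: n => n IH; have := d0 n.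
rewrite fpsM big_ord_recr big1 /= => [|i _]; last by rewrite IH ?mul0r.
by rewrite add0r subnn fps_expr0 // mulr1.
Qed.

(** Apply the residue invariance to [G' k^{n+1}]: after substitution [k] becomes [a], whose power
    cancels that of [b] and leaves the derivative of [G o g]. *)
Lemma lagrange_coef k G n : fcomp k g = a ->
  (fps_deriv G * k ^+ n.+1) n = (fcomp G g) n.+1 *+ n.+1.
Proof.
move=> kg; have g0 : g 0%N = 0 := fpsXM0 a.
rewrite -[LHS]fps_residue_comp fps_compM // fps_compX // kg.
have -> : fcomp (fps_deriv G) g * a ^+ n.+1 * fps_deriv g * b ^+ n.+1 =
    fcomp (fps_deriv G) g * fps_deriv g * (a * b) ^+ n.+1.
  by rewrite exprMn; ring.
by rewrite ab1 expr1n mulr1 -fps_deriv_comp.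
Qed.

End Lagrange.

(** * Sheffer sequences *)

Section Sheffer.
Context {C : numFieldType} {A : comAlgType C}.
Variables alpha gamma : umbra A.
Local Notation ser u := (series_of u : fps A).
Local Notation fcomp f g := (fps_comp f g : fps A).

Let b : fps A := fps_pow (series_of alpha) (-1).
Let g : fps A := fpsX * ser alpha.

Let alpha_b : ser alpha * b = 1.
Proof. by apply: fps_powN1; apply: series_of0. Qed.

Let b0 : b 0%N = 1. Proof. exact: fps_pow0. Qed.

Lemma abel_umbra_comp (d : umbra A) :
  fcomp (series_of (abel_umbra d alpha)) g = ser d.
Proof.
apply: (lagrange_inversion alpha_b b0) => [|n]; first by rewrite !series_of0.
(* Symbols with different constructors are distinct, hence uncorrelated, whatever their series. *)
have da : Prim d != ScalDot (- n.+1%:R) alpha :> symbol A by apply/eqP.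
rewrite /= (E_mul_addX _ (um_series_apart da)) /=.
(* The factor [n+1] from the derivative completes [n!] to [(n+1)!], which cancels the normalisation
   in [abel_series]. *)
rewrite -scalerMnr -mulrnA mulnC -factS -scaler_nat scalerA mulfV; last first.
  by rewrite pnatr_eq0 -lt0n fact_gt0.
by rewrite scale1r (fps_pow_oppn _ (series_of0 alpha) alpha_b).
Qed.

Lemma sheffer_series (x : A) n :
  sheffer gamma alpha x n = (ser gamma * fcomp (exp_series x) g) n *+ n`!.
Proof.
have gs : Prim gamma != ScalDot x (Defs.Dot (bell_umbra A) (Deriv alpha)).
  by apply/eqP.
rewrite /sheffer (E_addX _ (um_series_apart gs)) /=.
rewrite (fps_pow_bell_dot _ (series_of0 (Deriv alpha))).
(* The derivative umbra has series [1 + z f_alpha], so subtracting 1 leaves exactly [g]. *)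
suff -> : fps_sub1 (series_of (Deriv alpha)) = g by [].
apply/funext => -[|m]; rewrite /fps_sub1 /g.
  by rewrite fpsXM0 /= subrr.
by rewrite fpsXMS /= subr0.
Qed.

Lemma abel_product (x : A) n :
  E ((uconst x + um (abel_umbra gamma alpha)) *
     (uconst x + um (abel_umbra gamma alpha)
        + um (ScalDot n.+1%:R (abel_umbra alpha alpha))) ^+ n) =
  sheffer gamma alpha x n.+1.
Proof.
have ks : abel_umbra gamma alpha != ScalDot n.+1%:R (abel_umbra alpha alpha).
  by apply/eqP.
rewrite (E_mul_addX _ (const_add_um_series_apart x ks)).
have -> : series_of (ScalDot n.+1%:R (abel_umbra alpha alpha)) =
    ser (abel_umbra alpha alpha) ^+ n.+1.
  exact: (fps_pow_nat _ (series_of0 (abel_umbra alpha alpha))).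
(* Here [k] is the series of [K_alpha], which [g] carries to [f_alpha], and [G] is [e^{xz}] times
   the series of [K_{gamma,alpha}]. *)
rewrite (lagrange_coef alpha_b _ _ (abel_umbra_comp alpha)) -mulrnA -factS.
rewrite fps_compM ?fpsXM0 // abel_umbra_comp mulrC.
by rewrite sheffer_series.
Qed.

(** The umbral condition starts at [n = 1], so the hypothesis [s_0] provides the initial term in the
    converse direction. *)
Lemma is_sheffer_sequence_iff (x : A) (s : nat -> A) (s_0 : s 0%N = 1) :
  is_sheffer_sequence gamma alpha x s <->
  (forall n : nat, (1 <= n)%N ->
     umbral_equiv (uconst (s n))
       ((uconst x + um (abel_umbra gamma alpha)) *
        (uconst x + um (abel_umbra gamma alpha)
           + um (ScalDot n%:R (abel_umbra alpha alpha))) ^+ n.-1)).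
Proof.
rewrite /umbral_equiv; split=> [sh [//|n] _ | sh [|n]].
- by rewrite E_const sh abel_product.
- by rewrite s_0 /sheffer expr0 E_1.
- by rewrite -abel_product -(sh n.+1 isT) E_const.
Qed.

End Sheffer.

Theorem mainTheorem5 (R : realType) (k : nat) (j : 'I_k)
    (alpha gamma : umbra (mpoly k R[i]))
    (s : nat -> mpoly k R[i]) (s_0 : s 0%N = 1) :
  let x : mpoly k R[i] := 'X_j in
  is_sheffer_sequence gamma alpha x s <->
  (forall n : nat, (1 <= n)%N ->
     umbral_equiv (uconst (s n))
       ((uconst x + um (abel_umbra gamma alpha)) *
        (uconst x + um (abel_umbra gamma alpha)
           + um (ScalDot n%:R (abel_umbra alpha alpha))) ^+ n.-1)).
Proof.
exact: is_sheffer_sequence_iff.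
Qed.
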